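(* Let $m,n\ge 1$ and let $B$ be the $m\times n$ rectangular chessboard. There is no open knight's tour on $B$ (i.e. no Hamiltonian path in the knight's graph of $B$) that is crosspatch, i.e. in which every knight move of the tour forms a cross with some other knight move of the tour.
   Context: Represent the square in column $i$ and row $j$ of $B$ ($1\le i\le m$, $1\le j\le n$) by the point $(i,j)$ of the plane, and represent a knight move between two squares by the straight segment joining the corresponding points. Two knight moves form a cross (central cross) if the midpoints of their segments coincide. A set of knight moves (a knight graph) is called crosspatch if every move in it forms a cross with some other move in the set.
   Formalization: An open tour is also required to have two distinct end squares; this excludes only the one-square tour without moves on the 1×1 board, which is vacuously crosspatch and would make the claim false, and is automatic on every larger board. *)

(* Defs.v *)
From mathcomp Require Import all_boot all_order all_algebra.

Set Implicit Arguments.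
Unset Strict Implicit.
Unset Printing Implicit Defensive.

Import GRing.Theory.

(* A square is the pair (column, row), numbered from 0. *)
Notation square m n := ('I_m * 'I_n)%type.

Section Knight.

Variables m n : nat.

Implicit Types (p q : square m n) (s : seq (square m n)).
Implicit Types (e f : {set square m n}) (E : {set {set square m n}}).

Definition knight : rel (square m n) := fun p q =>
  let dx := absz (p.1%:Z - q.1%:Z)%R in let dy := absz (p.2%:Z - q.2%:Z)%R in
  ((dx == 1) && (dy == 2)) || ((dx == 2) && (dy == 1)).

Definition point p : rat * rat := ((p.1.+1)%:R%R, (p.2.+1)%:R%R).

(* An undirected move is the set of its two ends, so the midpoint of its
   segment is half the sum of the points of that set. *)
Definition midpoint e : rat * rat :=
  (((\sum_(p in e) (point p).1) / 2)%R, ((\sum_(p in e) (point p).2) / 2)%R).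

Definition cross e f : bool := midpoint e == midpoint f.

Definition crosspatch E : Prop :=
  forall e, e \in E -> exists f, [/\ f \in E, f != e & cross e f].

(* The tour visits the squares of p :: s in this order. The two ends of an
   open tour are distinct squares; on boards with more than one square this
   already follows from the other clauses, and it only excludes the path
   without moves on the 1 x 1 board, for which crosspatch holds vacuously. *)
Definition open_tour p s : Prop :=
  [/\ path knight p s, uniq (p :: s), forall q, q \in p :: s & p != last p s].

Definition tour_moves p s : {set {set square m n}} :=
  [set [set pq.1; pq.2] | pq in zip (p :: s) s].

End Knight.

(* Main.v *)
(** The two moves of a cross are the diagonals of a rectangle with sides
    parallel to the axes, so they have equally many ends in any given row, and
    likewise in any given column.  In a crosspatch path the moves with exactly
    one end in a given row therefore come in pairs.  Their number has the parity
    of the number of ends of the path lying in that row, so both ends of the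
    path lie in the same row; likewise they lie in the same column, and so they
    coincide. *)
Require Import Defs.
From mathcomp Require Import all_boot all_order all_algebra.
From mathcomp Require Import zify.

Set Implicit Arguments.
Unset Strict Implicit.
Unset Printing Implicit Defensive.

Import GRing.Theory Num.Theory.

(** Deleting an orbit [x], [f x] removes exactly two elements and leaves a set on which the
    hypotheses still hold. *)
Lemma odd_card_involution (T : finType) (f : T -> T) (A : {set T}) :
    {in A, forall x, [/\ f x \in A, f x != x & f (f x) = x]} ->
  odd #|A| = false.
Proof.
have [k] := ubnP #|A|; elim: k A => // k IHk A leAk fA.
have [->|[x xA]] := set_0Vmem A; first by rewrite cards0.
have [fxA fxx ffx] := fA x xA.
have fxA' : f x \in A :\ x by rewrite in_setD1 fxx.
have cardA := cardsD1 x A; have cardA' := cardsD1 (f x) (A :\ x).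
rewrite xA in cardA; rewrite fxA' in cardA'.
rewrite cardA cardA' /= negbK; apply: IHk => [|y]; first by lia.
rewrite !in_setD1 => /and3P[yfx yx yA]; have [fyA fyy ffy] := fA y yA.
split=> //; rewrite fyA andbT; apply/andP; split.
  by apply: contra_neq yx => eq_f; rewrite -ffy eq_f ffx.
by apply: contra_neq yfx => eq_x; rewrite -ffy eq_x.
Qed.

Section Moves.

Variables m n : nat.
Implicit Types (p q u v : square m n) (s : seq (square m n)).
Implicit Types (e f : {set square m n}) (c : pred (square m n)).

Lemma knight_neq p q : knight p q -> (p.1 != q.1) && (p.2 != q.2).
Proof. by rewrite /knight -!val_eqE /=; lia. Qed.

Lemma midpoint_set2 p q : p != q ->
  midpoint [set p; q] =
    ((p.1.+1 + q.1.+1)%:R / 2, (p.2.+1 + q.2.+1)%:R / 2)%R.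
Proof.
by move=> npq; rewrite /midpoint !big_setU1 ?inE //= !big_set1 /= !natrD.
Qed.

(** The product of the two projections of a move consists of the four corners of its bounding
    rectangle; removing the move leaves the other diagonal. *)
Definition twin e : {set square m n} :=
  setX [set p.1 | p in e] [set p.2 | p in e] :\: e.

Lemma twin_set2 p q : p.1 != q.1 -> p.2 != q.2 ->
  twin [set p; q] = [set (p.1, q.2); (q.1, p.2)].
Proof.
case: p q => [a b] [c d] /= nac nbd; rewrite /twin !imsetU1 !imset_set1 /=.
apply/setP=> -[x y]; rewrite !inE !xpair_eqE.
have [->|_] := eqVneq x a; have [->|_] := eqVneq y b; rewrite ?eqxx ?andbF //=;
  rewrite ?(negPf nac) ?(negPf nbd) ?orbF ?andbT //=.
all: by case: eqVneq => // _; case: eqVneq => //.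
Qed.

Lemma cross_twin p q u v : knight p q -> knight u v ->
  [set u; v] != [set p; q] -> cross [set p; q] [set u; v] ->
  [set u; v] = twin [set p; q].
Proof.
move=> kpq kuv; have /andP[n1 n2] := knight_neq kpq.
have npq : p != q by apply: contra_neq n1 => ->.
have nuv : u != v.
  by have /andP[/eqP n1' _] := knight_neq kuv; apply/eqP => uv; rewrite uv in n1'.
move=> neq; rewrite /cross !midpoint_set2 // xpair_eqE.
have two_inj : injective (fun x : rat => x / 2)%R by apply: mulIf.
rewrite !(inj_eq two_inj) !eqr_nat => /andP[/eqP eq1 /eqP eq2].
rewrite twin_set2 //.
(* Along each axis the two moves have equal coordinate sums, hence differences of equal parity. A
   difference is 1 or 2, so the differences agree, and with them the unordered pairs of
   coordinates. *)
have [eqs1 eqs2] :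
    ((u.1 == p.1) && (v.1 == q.1) || (u.1 == q.1) && (v.1 == p.1)) /\
    ((u.2 == p.2) && (v.2 == q.2) || (u.2 == q.2) && (v.2 == p.2)).
  by move: kpq kuv; rewrite /knight -!val_eqE /=; lia.
move: neq eqs1 eqs2; case: u {kuv nuv eq1 eq2} v => [a b] [c d] /=.
rewrite [p in _ != [set p; _]]surjective_pairing.
rewrite [q in _ != [set _; q]]surjective_pairing.
move=> neq /orP[]/andP[/eqP ? /eqP ?] /orP[]/andP[/eqP ? /eqP ?]; subst => //.
- by rewrite eqxx in neq.
- by rewrite setUC.
- by rewrite setUC eqxx in neq.
Qed.

Lemma tour_moves_cons p q s :
  tour_moves p (q :: s) = [set p; q] |: tour_moves q s.
Proof.
apply/setP=> e; rewrite in_setU1; apply/imsetP/idP.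
  case=> -[u v]; rewrite [zip _ _]/= inE => /orP[/eqP[-> ->]|uv] -> /=.
    by rewrite eqxx.
  by apply/orP; right; apply/imsetP; exists (u, v).
case/predU1P=> [->|/imsetP[uv uvs ->]]; first by exists (p, q); rewrite ?inE ?eqxx.
by exists uv => //; rewrite /= inE uvs orbT.
Qed.

Lemma tour_movesP p s e : path (@knight m n) p s -> e \in tour_moves p s ->
  exists u v, [/\ knight u v, e = [set u; v] & e \subset p :: s].
Proof.
elim: s p => [|q s IHs] p /=.
  by move=> _ /imsetP[].
case/andP=> kpq kqs; rewrite tour_moves_cons in_setU1 => /predU1P[->|].
  exists p, q; split=> //; apply/subsetP=> x.
  by rewrite !inE => /orP[]->; rewrite ?orbT.
case/(IHs q kqs) => u [v [kuv -> /subsetP sub]]; exists u, v; split=> //.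
by apply/subsetP=> x /sub xs; rewrite inE xs orbT.
Qed.

(** For a move, which has two ends, odd means that exactly one end satisfies [c]. *)
Definition splits c e := odd #|[set x in e | c x]|.

Lemma splits_set2 c p q : p != q -> splits c [set p; q] = c p (+) c q.
Proof.
move=> npq; rewrite /splits -sum1_card.
under eq_bigl do rewrite in_set.
by rewrite big_mkcondr big_setU1 ?inE //= big_set1 oddD; case: (c p); case: (c q).
Qed.

(** Modulo 2, the sum of [c u (+) c v] over the moves telescopes along the path. *)
Lemma odd_card_splits c p s : path (@knight m n) p s -> uniq (p :: s) ->
  odd #|[set e in tour_moves p s | splits c e]| = c p (+) c (last p s).
Proof.
elim: s p => [|q s IHs] p.
  move=> _ _; rewrite /= addbb eq_card0 // => e; rewrite !inE.
  by apply/negP => /andP[/imsetP[]].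
move=> /= /andP[kpq kqs] /andP[pqs uqs].
have npq : p != q by move: pqs; rewrite inE negb_or => /andP[].
(* No later move touches [p], so the first move is counted only once in the set of moves. *)
have pq_new : [set p; q] \notin tour_moves q s.
  apply/negP => /(tour_movesP kqs)[u [v [_ _ /subsetP/(_ p)]]].
  by rewrite set21 (negPf pqs) => /(_ isT).
have -> : c p (+) c (last q s) =
    splits c [set p; q] (+) (c q (+) c (last q s)).
  by rewrite splits_set2 // addbA addbK.
rewrite -IHs // tour_moves_cons (cardsD1 [set p; q]) !inE eqxx /= oddD oddb.
congr (_ (+) odd _); apply: eq_card => e; rewrite !inE.
by have [->|] := eqVneq e [set p; q]; rewrite ?(negPf pq_new).
Qed.

(** The last hypothesis says that a move and its twin split alike; it holds when [c] depends on one
    coordinate only. Then [twin] pairs off the split moves. *)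
Lemma crosspatch_ends c p s : path (@knight m n) p s -> uniq (p :: s) ->
    crosspatch (tour_moves p s) ->
    (forall u v, c (u.1, v.2) (+) c (v.1, u.2) = c u (+) c v) ->
  c p = c (last p s).
Proof.
move=> kps ups cps c_swap; apply/eqP/negPn; rewrite negb_eqb -odd_card_splits //.
apply/negbT/(@odd_card_involution _ twin) => e.
rewrite inE => /andP[eE ce]; have [f [fE nfe cef]] := cps e eE.
have [u [v [kuv def_e _]]] := tour_movesP kps eE.
have [u' [v' [kuv' def_f _]]] := tour_movesP kps fE.
have /andP[n1 n2] := knight_neq kuv.
have nuv : u != v by apply: contra_neq n1 => ->.
have twin_e : f = twin e by rewrite def_e def_f in nfe cef *; apply: cross_twin.
rewrite inE -twin_e; split=> //.
  rewrite fE twin_e def_e twin_set2 // splits_set2 ?xpair_eqE ?(negPf n1) //.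
  by rewrite c_swap -splits_set2 // -def_e.
rewrite twin_e def_e (twin_set2 n1 n2) twin_set2 //= 1?eq_sym //.
by rewrite -!surjective_pairing.
Qed.

End Moves.

Theorem theorem3 (m n : nat) (hm : 1 <= m) (hn : 1 <= n) :
  ~ exists (p : square m n) (s : seq (square m n)),
      open_tour p s /\ crosspatch (tour_moves p s).
Proof.
case=> p [s [[kps ups _ /eqP nps] cps]]; apply: nps.
(* Here [c] tests membership in the column of [p], which is true at [p] and so at the last
   square. *)
have /eqP eq1 : (last p s).1 == p.1.
  by rewrite -(crosspatch_ends (c := fun q => q.1 == p.1) kps ups cps).
have /eqP eq2 : (last p s).2 == p.2.
  rewrite -(crosspatch_ends (c := fun q => q.2 == p.2) kps ups cps) //= => u v.
  exact: addbC.
by case: (last p s) eq1 eq2 => a b /= -> ->; case: (p).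
Qed.
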